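(* Let $G$ and $H$ be connected graphs, each with at least one edge, such that $|\chi(G)-\chi(H)|\le 2$. Then $\chi(G\,\square\,H)\le \eta(G\,\square\,H)$. Moreover, if $|\chi(G)-\chi(H)|\le 1$ then $\chi(G\,\square\,H)\le \eta(G\,\square\,H)-1$.
   Context: All graphs are finite, simple and undirected. $\chi$ denotes chromatic number and $\eta(G)$ is the maximum $k$ such that $K_k$ is a minor of $G$. The Cartesian product $G\,\square\,H$ has vertex set $V(G)\times V(H)$, with $(v,x)(w,y)$ an edge iff ($vw\in E(G)$ and $x=y$) or ($v=w$ and $xy\in E(H)$). *)

(* Defs.v *)
From mathcomp Require Import all_boot all_order all_algebra.

Set Implicit Arguments.
Unset Strict Implicit.
Unset Printing Implicit Defensive.

Record sgraph := SGraph {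
  vertex :> finType;
  edge : rel vertex;
  edge_sym : symmetric edge;
  edge_irrefl : irreflexive edge
}.

(* A connected set of vertices is nonempty by convention, so the graph with no
   vertices is not connected. *)
Definition connected_set (G : sgraph) (A : {set G}) : bool :=
  (A != set0) &&
  [forall x in A, forall y in A, connect [rel u v in A | edge u v] x y].

Definition connected_graph (G : sgraph) : bool := connected_set [set: G].

Definition colorable (G : sgraph) (k : nat) : bool :=
  [exists c : {ffun G -> 'I_k},
    [forall x, forall y, edge x y ==> (c x != c y)]].

Lemma ex_colorable (G : sgraph) : exists k, colorable G k.
Proof.
exists #|G|; apply/existsP; exists [ffun x => enum_rank x].
apply/forallP => x; apply/forallP => y; apply/implyP => xy.
rewrite !ffunE (inj_eq enum_rank_inj).
by apply: contraTneq xy => ->; rewrite edge_irrefl.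
Qed.

Definition chromatic_number (G : sgraph) : nat := ex_minn (ex_colorable G).

Definition neq_rel (k : nat) : rel 'I_k := fun i j => i != j.

Lemma neq_rel_sym (k : nat) : symmetric (@neq_rel k).
Proof. by move=> i j; rewrite /neq_rel eq_sym. Qed.

Lemma neq_rel_irrefl (k : nat) : irreflexive (@neq_rel k).
Proof. by move=> i; rewrite /neq_rel eqxx. Qed.

Definition complete_graph (k : nat) : sgraph :=
  SGraph (@neq_rel_sym k) (@neq_rel_irrefl k).

(* The branch sets of a model of H in G: phi h is the set of vertices of G
   that are contracted into the vertex h of H. *)
Definition minor_model (H G : sgraph) (phi : {ffun H -> {set G}}) : bool :=
  [&& [forall h, connected_set (phi h)],
      [forall h, forall h', (h != h') ==> [disjoint phi h & phi h']] &
      [forall h, forall h', edge h h' ==>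
        [exists x in phi h, exists y in phi h', edge x y]]].

Definition minor (H G : sgraph) : bool :=
  [exists phi : {ffun H -> {set G}}, minor_model phi].

Lemma ex_complete_minor (G : sgraph) : exists k, minor (complete_graph k) G.
Proof.
exists 0; apply/existsP; exists [ffun=> set0].
by apply/and3P; split; apply/forallP; case.
Qed.

Lemma complete_minor_bound (G : sgraph) (k : nat) :
  minor (complete_graph k) G -> k <= #|G|.
Proof.
case/existsP=> phi /and3P[/forallP conn /forallP disj _].
have ne (i : 'I_k) : {x | x \in phi i}.
  by apply/sigW/set0Pn; case/andP: (conn i).
rewrite -[k]card_ord; apply: (leq_card (fun i => sval (ne i))) => i j eq_ij.
apply: contraTeq (svalP (ne j)) => neq_ij.
have /implyP/(_ neq_ij) := forallP (disj i) j.
by move/disjointFr => -> //; rewrite -eq_ij (svalP (ne i)).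
Qed.

Definition hadwiger_number (G : sgraph) : nat :=
  ex_maxn (ex_complete_minor G) (@complete_minor_bound G).

Section CartesianProduct.
Variables G H : sgraph.

Definition cart_rel : rel (G * H) := fun p q =>
  (edge p.1 q.1 && (p.2 == q.2)) || ((p.1 == q.1) && edge p.2 q.2).

Lemma cart_rel_sym : symmetric cart_rel.
Proof.
by move=> p q; rewrite /cart_rel !(edge_sym q.1, edge_sym q.2) !(eq_sym q.1, eq_sym q.2).
Qed.

Lemma cart_rel_irrefl : irreflexive cart_rel.
Proof. by move=> p; rewrite /cart_rel !edge_irrefl andbF. Qed.

Definition cartesian_product : sgraph := SGraph cart_rel_sym cart_rel_irrefl.

End CartesianProduct.

(* Main.v *)
Require Import Defs.
From mathcomp Require Import all_boot all_order all_algebra zify.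

(* The proof replaces chi by two consequences of not being k-colourable.  A
   graph that is not k-colourable has a vertex of degree at least k, and, unless
   it has a K_{k+1} minor, even a connected set with more than k neighbours (a
   weak form of Brooks' theorem).  If S and T are connected sets with at least d
   neighbours each, then contracting S and T makes G x H contain a product of
   two stars K_{1,d}, which has a K_{d+2} minor.  In the remaining case H has a
   K_m minor and G, not being 2-colourable, a K_3 minor; then K_3 x K_m has a
   K_{m+2} minor.  Finally chi(G x H) = max(chi G, chi H). *)

Set Implicit Arguments.
Unset Strict Implicit.
Unset Printing Implicit Defensive.

(** * Connected and adjacent sets of vertices *)

Section ConnectedSets.
Variable G : sgraph.
Implicit Types (x y z : G) (A B : {set G}).

Definition adjacent A B := [exists x in A, exists y in B, edge x y].

Lemma adjacentP A B :
  reflect (exists x y, [/\ x \in A, y \in B & edge x y]) (adjacent A B).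
Proof.
apply: (iffP exists_inP) => [[x xA /exists_inP[y yB xy]]|[x [y [xA yB xy]]]].
  by exists x, y.
by exists x => //; apply/exists_inP; exists y.
Qed.

Lemma adjacent_sym A B : adjacent A B = adjacent B A.
Proof.
by apply/adjacentP/adjacentP => -[x [y [xA yB xy]]]; exists y, x; rewrite edge_sym.
Qed.

Lemma adjacentS A B A' B' :
  A \subset A' -> B \subset B' -> adjacent A B -> adjacent A' B'.
Proof.
move=> /subsetP sA /subsetP sB /adjacentP[x [y [xA yB xy]]].
by apply/adjacentP; exists x, y; rewrite sA ?sB.
Qed.

Lemma connect_in_sym A : connect_sym [rel u v in A | edge u v].
Proof. by apply: sym_connect_sym => u v /=; rewrite edge_sym [(u \in A) && _]andbC. Qed.

Lemma connect_inS A B x y : A \subset B ->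
  connect [rel u v in A | edge u v] x y -> connect [rel u v in B | edge u v] x y.
Proof.
move=> /subsetP sAB; apply: connect_sub => u v /= /andP[/andP[uA vA] uv].
by rewrite connect1 //= !sAB.
Qed.

(** Reachability within [A] is symmetric, so paths from one base vertex suffice. *)
Lemma connected_setP A :
  reflect (exists2 x, x \in A &
             forall y, y \in A -> connect [rel u v in A | edge u v] x y)
          (connected_set A).
Proof.
apply: (iffP andP) => [[/set0Pn[x xA] /forall_inP cA]|[x xA cA]].
  by exists x => // y; apply/forall_inP: y; apply: cA.
split; first by apply/set0Pn; exists x.
apply/forall_inP => y yA; apply/forall_inP => z zA.
by apply: (@connect_trans _ _ x); [rewrite connect_in_sym|]; apply: cA.
Qed.

Lemma connected_set_connect A x y : connected_set A -> x \in A -> y \in A ->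
  connect [rel u v in A | edge u v] x y.
Proof. by case/andP=> _ /forall_inP cA /cA/forall_inP; apply. Qed.

Lemma connected_set1 x : connected_set [set x].
Proof.
by apply/connected_setP; exists x => [|y]; rewrite inE // => /eqP->.
Qed.

Lemma connected_setU A B :
  connected_set A -> connected_set B -> adjacent A B -> connected_set (A :|: B).
Proof.
move=> cA cB /adjacentP[x [y [xA yB xy]]].
apply/connected_setP; exists x => [|z]; first by rewrite inE xA.
rewrite inE => /orP[zA|zB].
  by apply: connect_inS (connected_set_connect cA xA zA); apply: subsetUl.
apply: (@connect_trans _ _ y); first by rewrite connect1 //= !inE xA yB orbT.
by apply: connect_inS (connected_set_connect cB yB zB); apply: subsetUr.
Qed.

Lemma connected_set_path x p : path (@edge G) x p ->
  connected_set [set y in x :: p].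
Proof.
elim: p x => [|y p IHp] x /= => [_|/andP[xy /IHp cp]].
  by rewrite set_cons set_nil setU0 connected_set1.
rewrite set_cons connected_setU ?connected_set1 //.
by apply/adjacentP; exists x, y; rewrite !inE !eqxx.
Qed.

End ConnectedSets.

(** * Complete minors as families of branch sets *)

Section CliqueMinors.
Variable G : sgraph.
Implicit Types A B : {set G}.

Definition disjoint_adjacent : rel {set G} :=
  fun A B => [disjoint A & B] && adjacent A B.

Lemma disjoint_adjacent_sym : symmetric disjoint_adjacent.
Proof.
by move=> A B; rewrite /disjoint_adjacent disjoint_sym adjacent_sym.
Qed.

(** Lists let branch sets of different shapes be put together; [pairwise] compares earlier with
    later entries only, and symmetry of [disjoint_adjacent] supplies the rest. *)
Lemma complete_minor_seq (s : seq {set G}) :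
  all (@connected_set G) s -> pairwise disjoint_adjacent s ->
  minor (complete_graph (size s)) G.
Proof.
move=> /allP cs ps; apply/existsP; exists [ffun i : 'I_(size s) => nth set0 s i].
have adj (i j : 'I_(size s)) : i != j ->
    disjoint_adjacent (nth set0 s i) (nth set0 s j).
  wlog lt_ij : i j / i < j => [IH neq_ij|_].
    case: (ltngtP i j) => [|lt_ji|/val_inj eq_ij]; first by move/IH; apply.
      by rewrite disjoint_adjacent_sym IH // eq_sym.
    by rewrite eq_ij eqxx in neq_ij.
  by move/(pairwiseP set0): ps; apply; rewrite ?inE.
apply/and3P; split.
- by apply/forallP => i; rewrite ffunE cs ?mem_nth.
- apply/forallP => i; apply/forallP => j; apply/implyP => /adj/andP[].
  by rewrite !ffunE.
- apply/forallP => i; apply/forallP => j; apply/implyP => /adj/andP[_].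
  by rewrite !ffunE.
Qed.

Lemma complete_minorP k :
  reflect (exists f : 'I_k -> {set G}, (forall i, connected_set (f i)) /\
             forall i j, i != j -> disjoint_adjacent (f i) (f j))
          (minor (complete_graph k) G).
Proof.
apply: (iffP existsP) => [[phi /and3P[/forallP c /forallP d /forallP a]]|].
  exists phi; split=> // i j ij; apply/andP; split.
    by have /forallP/(_ j)/implyP := d i; apply.
  by have /forallP/(_ j)/implyP := a i; apply.
case=> f [cf df]; exists [ffun i => f i]; apply/and3P; split.
- by apply/forallP => i; rewrite ffunE.
- apply/forallP => i; apply/forallP => j; apply/implyP => /df/andP[].
  by rewrite !ffunE.
- apply/forallP => i; apply/forallP => j; apply/implyP => /df/andP[_].
  by rewrite !ffunE.
Qed.

Lemma leq_hadwiger k : minor (complete_graph k) G -> k <= hadwiger_number G.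
Proof. by rewrite /hadwiger_number; case: ex_maxnP => i _; apply. Qed.

Lemma pairwise_enum (I : finType) (f : I -> {set G}) :
  (forall i j, i != j -> disjoint_adjacent (f i) (f j)) ->
  pairwise disjoint_adjacent [seq f i | i <- enum I].
Proof.
move=> df; rewrite pairwise_map.
have: pairwise [rel i j | i != j] (enum I) by rewrite -uniq_pairwise enum_uniq.
by apply: sub_pairwise => i j; apply: df.
Qed.

End CliqueMinors.

(** * Rectangles in the Cartesian product *)

Lemma connect_homo (T T' : finType) (e : rel T) (e' : rel T') (h : T -> T') :
  {homo h : x y / e x y >-> e' x y} ->
  {homo h : x y / connect e x y >-> connect e' x y}.
Proof.
move=> he x _ /connectP[p ep ->]; elim: p x ep => //= y p IHp x /andP[xy yp].
exact: connect_trans (connect1 (he _ _ xy)) (IHp _ yp).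
Qed.

Section ProductSets.
Variables G H : sgraph.
Local Notation GH := (cartesian_product G H).
Implicit Types (A : {set G}) (B : {set H}).

Definition prodset A B : {set GH} := setX A B.

Lemma in_prodset A B (p : GH) : (p \in prodset A B) = (p.1 \in A) && (p.2 \in B).
Proof. by rewrite inE. Qed.

(** From [(x, y)], walk inside [A] at height [y], then inside [B] over the vertex reached. *)
Lemma connected_prodset A B :
  connected_set A -> connected_set B -> connected_set (prodset A B).
Proof.
move=> cA cB; have [x xA _] := connected_setP _ cA.
have [y yB _] := connected_setP _ cB.
apply/connected_setP; exists (x, y) => [|[x' y']]; rewrite in_prodset /= ?xA //.
case/andP=> x'A y'B; apply: (@connect_trans _ _ (x', y)).
  apply: (connect_homo (h := fun u => (u, y)) _ (connected_set_connect cA xA x'A)).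
  by move=> u v /= /andP[/andP[uA vA] uv]; rewrite !in_prodset /cart_rel /= uA vA yB uv eqxx.
apply: (connect_homo (h := fun u => (x', u)) _ (connected_set_connect cB yB y'B)).
by move=> u v /= /andP[/andP[uA vA] uv]; rewrite !in_prodset /cart_rel /= uA vA x'A uv eqxx orbT.
Qed.

Lemma adjacent_prodsetl A A' B B' y : adjacent A A' -> y \in B -> y \in B' ->
  adjacent (prodset A B) (prodset A' B').
Proof.
case/adjacentP=> x [x' [xA x'A xx']] yB yB'; apply/adjacentP.
by exists (x, y), (x', y); rewrite !in_prodset /= /cart_rel xA x'A yB yB' /= xx' eqxx.
Qed.

Lemma adjacent_prodsetr A A' B B' x : adjacent B B' -> x \in A -> x \in A' ->
  adjacent (prodset A B) (prodset A' B').
Proof.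
case/adjacentP=> y [y' [yB y'B yy']] xA xA'; apply/adjacentP.
by exists (x, y), (x, y'); rewrite !in_prodset /= /cart_rel xA xA' yB y'B /= yy' eqxx orbT.
Qed.

Lemma disjoint_prodset A A' B B' :
  [disjoint A & A'] || [disjoint B & B'] ->
  [disjoint prodset A B & prodset A' B'].
Proof.
move=> dAB; rewrite -setI_eq0; apply/eqP/setP => -[x y]; rewrite !inE /=.
apply/negP => /andP[/andP[xA yB] /andP[xA' yB']].
by case/orP: dAB => /disjointFr; [move/(_ x xA)|move/(_ y yB)]; rewrite ?xA' ?yB'.
Qed.

(* The branch sets are phi_0 x psi_i, phi_1 x V(H) and phi_2 x V(H). *)
Lemma minor_triangle_complete k : connected_graph H ->
  minor (complete_graph 3) G -> minor (complete_graph k.+1) H ->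
  minor (complete_graph k.+3) GH.
Proof.
move=> cH /complete_minorP[phi [cphi dphi]] /complete_minorP[psi [cpsi dpsi]].
pose X i := prodset (phi (inord i)) setT.
pose Y i := prodset (phi ord0) (psi i).
have dphi' i j : i < 3 -> j < 3 -> i != j ->
    disjoint_adjacent (phi (inord i)) (phi (inord j)).
  by move=> i3 j3 ij; apply: dphi; rewrite -val_eqE /= !inordK.
have inord0 : inord 0 = ord0 :> 'I_3 by apply: val_inj; rewrite /= inordK.
have XY i j : 0 < i < 3 -> disjoint_adjacent (X i) (Y j).
  (* Both sets meet the layer of any [y] in [psi j], where an edge of [G] joins them. *)
  case/andP=> i0 i3; have [y yj _] := connected_setP _ (cpsi j).
  have /andP[d a] : disjoint_adjacent (phi (inord i)) (phi ord0).
    by rewrite -inord0 dphi' // -lt0n.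
  by rewrite /disjoint_adjacent disjoint_prodset ?d //= (adjacent_prodsetl (y := y)).
have XX : disjoint_adjacent (X 1) (X 2).
  have [y yj _] := connected_setP _ (cpsi ord0).
  have /andP[d a] := dphi' 1 2 isT isT isT.
  by rewrite /disjoint_adjacent disjoint_prodset ?d //= (adjacent_prodsetl (y := y)).
have YY i j : i != j -> disjoint_adjacent (Y i) (Y j).
  have [x xj _] := connected_setP _ (cphi ord0).
  case/dpsi/andP => d a.
  by rewrite /disjoint_adjacent disjoint_prodset ?d ?orbT //= (adjacent_prodsetr (x := x)).
have cX i : connected_set (X i) by apply: connected_prodset.
have cY i : connected_set (Y i) by apply: connected_prodset.
have -> : k.+3 = size [:: X 1, X 2 & [seq Y i | i <- enum 'I_k.+1]].
  by rewrite /= size_map size_enum_ord.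
apply: complete_minor_seq.
  by rewrite /= !cX all_map; apply/allP => i _ /=.
rewrite /= XX (pairwise_enum YY) andbT /= !all_map.
by apply/andP; split; apply/allP => i _ /=; apply: XY.
Qed.

End ProductSets.

(** * Products of two stars *)

Definition neighbours (G : sgraph) (S : {set G}) : {set G} :=
  [set y | (y \notin S) && [exists x in S, edge x y]].

Lemma neighboursP (G : sgraph) (S : {set G}) y :
  reflect (y \notin S /\ adjacent S [set y]) (y \in neighbours S).
Proof.
rewrite inE; apply: (iffP andP) => -[yS]; split=> //.
  by case/exists_inP: b => x xS xy; apply/adjacentP; exists x, y; rewrite inE.
by case/adjacentP: b => x [z [xS /set1P-> xy]]; apply/exists_inP; exists x.
Qed.

(* The branch sets are S x T, {f_d} x V(H), S x {g_d}, and for i < d the sets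
   ({f_i} x V(H)) U (S x {g_i}). *)
Lemma minor_stars (G H : sgraph) d (S : {set G}) (T : {set H}) :
    connected_graph H -> connected_set S -> connected_set T ->
    d < #|neighbours S| -> d < #|neighbours T| ->
  minor (complete_graph d.+3) (cartesian_product G H).
Proof.
move=> cH cS cT dS dT.
(* The strict bounds provide d + 1 neighbours on each side, indexed from 0 to d. *)
pose f (i : 'I_d.+1) : G := enum_val (widen_ord dS i).
pose g (i : 'I_d.+1) : H := enum_val (widen_ord dT i).
have f_inj i j : i != j -> f i != f j.
  by apply: contraNneq => /enum_val_inj/(congr1 val) /= /val_inj->.
have g_inj i j : i != j -> g i != g j.
  by apply: contraNneq => /enum_val_inj/(congr1 val) /= /val_inj->.
have fS i : f i \notin S by have /neighboursP[] := enum_valP (widen_ord dS i).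
have fA i : adjacent S [set f i] by have /neighboursP[] := enum_valP (widen_ord dS i).
have gT i : g i \notin T by have /neighboursP[] := enum_valP (widen_ord dT i).
have gA i : adjacent T [set g i] by have /neighboursP[] := enum_valP (widen_ord dT i).
pose X i := prodset [set f i] [set: H].
pose Y i := prodset S [set g i].
have cX i : connected_set (X i) by rewrite connected_prodset ?connected_set1.
have cY i : connected_set (Y i) by rewrite connected_prodset ?connected_set1.
have [x xS _] := connected_setP _ cS; have [y yT _] := connected_setP _ cT.
have fd i j : i != j -> [disjoint [set f i] & [set f j]].
  by move=> ij; rewrite disjoints1 inE f_inj.
have gd i j : i != j -> [disjoint [set g i] & [set g j]].
  by move=> ij; rewrite disjoints1 inE g_inj.
have fSd i : [disjoint [set f i] & S] by rewrite disjoints1.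
have gTd i : [disjoint [set g i] & T] by rewrite disjoints1.
(* An edge from [f i] to [S], taken in the layer [g j], joins the two sets. *)
have aXY i j : adjacent (X i) (Y j).
  by apply: (adjacent_prodsetl (y := g j)); rewrite ?inE // adjacent_sym.
have dXY i j : [disjoint X i & Y j] by rewrite disjoint_prodset ?fSd.
pose Z := prodset S T.
have ZX i : disjoint_adjacent Z (X i).
  rewrite disjoint_adjacent_sym /disjoint_adjacent disjoint_prodset ?fSd //=.
  by apply: (adjacent_prodsetl (y := y)); rewrite // adjacent_sym.
have ZY i : disjoint_adjacent Z (Y i).
  rewrite disjoint_adjacent_sym /disjoint_adjacent disjoint_prodset ?gTd ?orbT //=.
  by apply: (adjacent_prodsetr (x := x)); rewrite // adjacent_sym.
(* The index [l] is d, and [m] enumerates the others. Merging all d + 1 pairs would give, with [Z],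
   only d + 2 sets; leaving the last pair separate gains one. *)
pose l := @ord_max d; pose m i : 'I_d.+1 := lift l i.
have ml i : l != m i by apply: neq_lift.
pose B i := X (m i) :|: Y (m i).
have cB i : connected_set (B i) by apply: connected_setU.
have sXB i : X (m i) \subset B i by apply: subsetUl.
have sYB i : Y (m i) \subset B i by apply: subsetUr.
have dU (A A1 A2 : {set cartesian_product G H}) :
    [disjoint A & A1] -> [disjoint A & A2] -> [disjoint A & A1 :|: A2].
  by rewrite -!setI_eq0 setIUr setU_eq0 => -> ->.
have dX i j : i != j -> [disjoint X i & X j] by move/fd=> h; rewrite disjoint_prodset ?h.
have dY i j : i != j -> [disjoint Y i & Y j].
  by move/gd=> h; rewrite disjoint_prodset ?h ?orbT.
have BB i j : i != j -> disjoint_adjacent (B i) (B j).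
  rewrite -(inj_eq (@lift_inj _ l)) => ij; apply/andP; split.
    apply: (dU); rewrite disjoint_sym; apply: (dU); rewrite 1?disjoint_sym //.
    - by rewrite dX.
    - by rewrite disjoint_sym.
    - by rewrite dY.
  (* The [X] half of [B i] touches the [Y] half of [B j]: this is why the halves are merged. *)
  exact: adjacentS (aXY (m i) (m j)).
have ZB i : disjoint_adjacent Z (B i).
  have /andP[d1 a1] := ZX (m i); have /andP[d2 _] := ZY (m i).
  by rewrite /disjoint_adjacent dU //= (adjacentS _ _ a1).
have XB i : disjoint_adjacent (X l) (B i).
  by rewrite /disjoint_adjacent dU ?dX //= (adjacentS _ _ (aXY l (m i))).
have YB i : disjoint_adjacent (Y l) (B i).
  rewrite /disjoint_adjacent dU ?dY //= 1?disjoint_sym //.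
  by rewrite adjacent_sym (adjacentS _ _ (aXY (m i) l)).
have XY : disjoint_adjacent (X l) (Y l) by rewrite /disjoint_adjacent dXY aXY.
have -> : d.+3 = size [:: Z, X l, Y l & [seq B i | i <- enum 'I_d]].
  by rewrite /= size_map size_enum_ord.
apply: complete_minor_seq.
  by rewrite /= cX cY connected_prodset //= all_map; apply/allP => i _ /=.
rewrite /= (pairwise_enum BB) andbT /= !all_map ZX ZY XY.
by rewrite /= -!all_predI; apply/allP => i _ /=; rewrite ZB XB YB.
Qed.

(** Exchanging coordinates is an isomorphism, along which branch sets are pulled back. It reduces
    the theorem to the case where the first factor has the larger chromatic number. *)
Lemma minor_product_swap (G H : sgraph) k :
  minor (complete_graph k) (cartesian_product G H) ->
  minor (complete_graph k) (cartesian_product H G).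
Proof.
case/complete_minorP=> f [cf df]; apply/complete_minorP.
pose sw (p : H * G) : G * H := (p.2, p.1).
pose sw' (p : G * H) : H * G := (p.2, p.1).
exists (fun i => sw @^-1: f i); split=> [i|i j /df/andP[d a]].
  have [[x y] xy cc] := connected_setP _ (cf i).
  apply/connected_setP; exists (y, x); first by rewrite inE.
  case=> y' x'; rewrite inE => /cc; apply: (connect_homo (h := sw')).
  move=> [u1 u2] [v1 v2] /=; rewrite !inE => /andP[/andP[-> ->]].
  by rewrite /cart_rel /= orbC andbC [_ && edge u1 v1]andbC.
apply/andP; split.
  rewrite -setI_eq0 -preimsetI; move: d; rewrite -setI_eq0 => /eqP->.
  by rewrite preimset0.
case/adjacentP: a => -[x y] [[x' y'] [xy xy' e]].
apply/adjacentP; exists (y, x), (y', x'); rewrite !inE; split=> //.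
by move: e; rewrite /= /cart_rel /= orbC andbC [_ && edge x x']andbC.
Qed.

(** * Colour-critical sets, and the stars and cliques they contain *)

Section Colourings.
Variable G : sgraph.
Implicit Types (x y z u v w : G) (A B : {set G}).

(** The colouring is total, with arbitrary values outside [A]; this avoids forming induced
    subgraphs. *)
Definition colors_on k A (c : G -> 'I_k) :=
  forall x y, x \in A -> y \in A -> edge x y -> c x != c y.

(** For [0 < k], the subgraph induced on [A] is vertex-critical of chromatic number k + 1. *)
Definition critical k A :=
  (forall c : G -> 'I_k, ~ colors_on A c) /\
  (forall x, x \in A -> exists c : G -> 'I_k, colors_on (A :\ x) c).

Lemma colorableP k :
  reflect (exists c : G -> 'I_k, colors_on setT c) (colorable G k).
Proof.
apply: (iffP existsP) => [[c /forallP cc]|[c cc]].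
  by exists c => x y _ _; have /forallP/(_ y)/implyP := cc x.
exists [ffun x => c x]; apply/forallP => x; apply/forallP => y.
by apply/implyP => xy; rewrite !ffunE cc ?inE.
Qed.

(** Take an inclusion-minimal set that is not k-colourable. *)
Lemma exists_critical k : ~~ colorable G k -> exists A, critical k A.
Proof.
move=> ncol.
pose P A := ~~ [exists c : {ffun G -> 'I_k},
  [forall x in A, forall y in A, edge x y ==> (c x != c y)]].
have PP A : reflect (exists c : G -> 'I_k, colors_on A c) (~~ P A).
  rewrite negbK; apply: (iffP existsP) => [[c /forall_inP cc]|[c cc]].
    by exists c => x y xA yA; have /forall_inP/(_ y yA)/implyP := cc x xA.
  exists [ffun x => c x]; apply/forall_inP => x xA; apply/forall_inP => y yA.
  by apply/implyP => xy; rewrite !ffunE cc.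
have PT : P setT by apply: contraNT ncol => /PP/colorableP.
have [A /minsetP[PA minA] _] := minset_exists PT.
exists A; split=> [c cc|x xA].
  by have := introT (PP A) (ex_intro _ c cc); rewrite PA.
apply/PP; apply/negP => /minA/(_ (subsetDl _ _)) AE.
by have := setD11 x A; rewrite AE xA.
Qed.

Definition nbrs_in A x := [set y in A | edge x y].

Lemma critical_neq0 k A : 0 < k -> critical k A -> exists x, x \in A.
Proof.
case: k => // k _ [ncA _]; apply/set0Pn; apply/eqP => A0.
by apply: (ncA (fun=> ord0)) => x y; rewrite A0 inE.
Qed.

(* A colour missing on the neighbours of x extends a colouring of A - x. *)
Lemma critical_degree k A x : critical k A -> x \in A -> k <= #|nbrs_in A x|.
Proof.
case=> ncA cA xA; have [c cc] := cA x xA.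
rewrite leqNgt; apply/negP => lt_k.
have [i ni] : exists i, i \notin c @: nbrs_in A x.
  apply/existsP; rewrite -negb_forall; apply: contraTN lt_k => /forallP all_i.
  rewrite -leqNgt -{1}[k]card_ord -cardsT; apply: leq_trans (leq_imset_card c _).
  by apply: subset_leq_card; apply/subsetP => i _.
apply: (ncA (fun y => if y == x then i else c y)) => y z yA zA yz.
have nix u : u \in A -> edge x u -> i != c u.
  by move=> uA xu; apply: contraNneq ni => ->; rewrite imset_f // !inE uA.
have [yx|yx] := eqVneq y x; have [zx|zx] := eqVneq z x.
- by move: yz; rewrite yx zx edge_irrefl.
- by rewrite nix // -yx.
- by rewrite eq_sym nix // -zx edge_sym.
- by rewrite cc // !inE ?yx ?zx.
Qed.

(* Two non-adjacent vertices with N(w) contained in N(v): give w the colour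
   of v. *)
Lemma critical_nbrs_sub k A v w : critical k A -> v \in A -> w \in A -> v != w ->
  ~~ edge v w -> ~~ (nbrs_in A w \subset nbrs_in A v).
Proof.
case=> ncA cA vA wA nvw evw; apply/negP => /subsetP sN; have [c cc] := cA w wA.
have nv u : u \in A -> edge w u -> c v != c u.
  move=> uA wu; have := sN u; rewrite !inE uA => /(_ wu) vu.
  apply: cc => //; rewrite !inE ?nvw ?uA ?andbT //.
  by apply: contraTneq wu => ->; rewrite edge_irrefl.
apply: (ncA (fun y => if y == w then c v else c y)) => y z yA zA yz.
have [yx|yx] := eqVneq y w; have [zx|zx] := eqVneq z w.
- by move: yz; rewrite yx zx edge_irrefl.
- by rewrite nv // -yx.
- by rewrite eq_sym nv // -zx edge_sym.
- by rewrite cc // !inE ?yx ?zx.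
Qed.

(* Extend a path within the critical set at its head until its head has a
   neighbour on the path other than the next vertex. *)
Lemma minor_triangle k : 1 < k -> ~~ colorable G k -> minor (complete_graph 3) G.
Proof.
move=> k1 /exists_critical[A crA]; apply: contraT => nmin.
have [x xA] := critical_neq0 (ltnW k1) crA.
have [u uA ux] : exists2 u, u \in A & edge u x.
  have /card_gt0P[u] := leq_trans (ltnW k1) (critical_degree crA xA).
  by rewrite inE edge_sym => /andP[]; exists u.
(* Without a triangle minor the path can be extended forever, which length [#|G|] refutes below. *)
have long n : exists z y p, [/\ path (@edge G) z (y :: p), uniq [:: z, y & p],
    z \in A & size p = n].
  elim: n => [|n [z [y [p [zp up zA sp]]]]].
    exists u, x, [::]; rewrite /= ux inE !andbT; split=> //.
    by apply: contraTneq ux => ->; rewrite edge_irrefl.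
  have zy : edge z y by case/andP: zp.
  (* The head has degree at least 2, hence a second neighbour [t], which extends the path or closes
     a cycle. *)
  have [t] : exists t, t \in nbrs_in A z :\ y.
    apply/set0Pn; rewrite -card_gt0.
    have := leq_trans k1 (critical_degree crA zA).
    by rewrite (cardsD1 y); case: (y \in _) => /=; lia.
  rewrite !inE => /and3P[ty tA zt].
  have tz : t != z by apply: contraTneq zt => ->; rewrite edge_irrefl.
  case tp : (t \in p); last first.
    exists t, z, (y :: p); split; rewrite ?cons_uniq /= ?sp //.
      by move: zp => /= ->; rewrite edge_sym zt.
    by move: up => /= ->; rewrite !inE (negPf tz) (negPf ty) tp.
  (* The cycle is cut into [z], [y] and the segment of the path after [y] up to [t]; the first
     vertex [s] of that segment is adjacent to [y], its last vertex [t] to [z]. *)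
  case/negP: nmin; case/splitPr: p / tp zp up {sp} => p1 p2.
  rewrite -cat_rcons => zp up.
  have tE : t \in rcons p1 t by rewrite mem_rcons inE eqxx.
  case E : (rcons p1 t) zp up tE => [|s q] /=; first by move/(congr1 size): E; rewrite size_rcons.
  rewrite cat_path !inE !mem_cat !negb_or -!andbA.
  move=> /and4P[_ ys pq _] /and5P[_ nzs nzq _ /and4P[nys nyq _ _]] tq.
  apply: (@complete_minor_seq G [:: [set z]; [set y]; [set a in s :: q]]) => /=.
    by rewrite !connected_set1 connected_set_path.
  rewrite /disjoint_adjacent !disjoints1 !inE !andbT.
  have -> /= : z != y by apply: contraTneq zy => ->; rewrite edge_irrefl.
  rewrite !negb_or nzs nzq nys nyq /=; rewrite -andbA; apply/and3P; split; apply/adjacentP.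
  - by exists z, y; rewrite !inE.
  - by exists z, t; rewrite !inE.
  - by exists y, s; rewrite !inE !eqxx.
have [z [y [p [_ up _ sp]]]] := long #|G|.
by have := max_card (mem [:: z, y & p]); rewrite (card_uniqP up) /= sp ltnNge leqnSn.
Qed.

Lemma leq_card_neighbours A v : #|nbrs_in A v| <= #|neighbours [set v]|.
Proof.
apply/subset_leq_card/subsetP => y; rewrite !inE => /andP[_ vy]; apply/andP; split.
  by apply: contraTneq vy => ->; rewrite edge_irrefl.
by apply/exists_inP; exists v; rewrite ?inE.
Qed.

(** A single vertex of a critical set serves as [S], by the degree bound. *)
Lemma exists_star k : 0 < k -> ~~ colorable G k ->
  exists S : {set G}, connected_set S /\ k <= #|neighbours S|.
Proof.
move=> k0 /exists_critical[A crA]; have [v vA] := critical_neq0 k0 crA.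
exists [set v]; rewrite connected_set1; split=> //.
exact: leq_trans (critical_degree crA vA) (leq_card_neighbours A v).
Qed.

(* For k > 2 and stars excluded, a critical set A is k-regular and contains no
   induced path v - u - w: its end points would have the same neighbours in A,
   so that a colouring of A - w would extend to w. *)
Lemma star_or_complete_minor k : 0 < k -> ~~ colorable G k ->
  (exists S : {set G}, connected_set S /\ k < #|neighbours S|) \/
  minor (complete_graph k.+1) G.
Proof.
(* For k at most 2 the minor is found directly: a triangle for k = 2, an edge for k = 1. *)
move=> k0 ncol; have [k3|k3] := leqP k 2.
  have [k2|k1] := leqP 2 k.
    by right; have -> : k = 2; [lia | apply: (minor_triangle (k := k))].
  right; have k_1 : k = 1 by lia.
  have [A crA] := exists_critical ncol; have [v vA] := critical_neq0 k0 crA.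
  have /card_gt0P[u] := leq_trans k0 (critical_degree crA vA).
  rewrite inE => /andP[_ vu]; rewrite k_1.
  apply: (@complete_minor_seq G [:: [set v]; [set u]]); rewrite /= ?connected_set1 //.
  rewrite /disjoint_adjacent disjoints1 !inE !andbT.
  have -> /= : v != u by apply: contraTneq vu => ->; rewrite edge_irrefl.
  by apply/adjacentP; exists v, u; rewrite !inE.
have [A crA] := exists_critical ncol; have [v0 v0A] := critical_neq0 k0 crA.
pose star (S : {set G}) := connected_set S && (k < #|neighbours S|).
have [/existsP[S /andP[cS kS]]|/existsPn nstar] := boolP [exists S, star S].
  by left; exists S.
right.
have deg v : v \in A -> #|nbrs_in A v| = k.
  move=> vA; apply/eqP; rewrite eqn_leq (critical_degree crA vA) andbT leqNgt.
  apply: contra (nstar [set v]) => /leq_trans/(_ (leq_card_neighbours A v)).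
  by rewrite /star connected_set1.
have nbr x y : edge x y -> x != y.
  by move=> xy; apply: contraTneq xy => ->; rewrite edge_irrefl.
(* Otherwise {v, u} has too many neighbours: N(v) - u, w and x. *)
have comm u v w x : u \in A -> v \in A -> w \in A -> x \in A ->
    edge u v -> edge u w -> edge u x -> v != w -> ~~ edge v w ->
    x != v -> x != w -> edge v x.
  move=> uA vA wA xA uv uw ux nvw evw nxv nxw; apply: contraT => evx.
  have uvS : connected_set [set u; v].
    by rewrite connected_setU ?connected_set1 //; apply/adjacentP; exists u, v; rewrite !inE.
  case/negP: (nstar [set u; v]); rewrite /star uvS /=.
  have sub : w |: (x |: (nbrs_in A v :\ u)) \subset neighbours [set u; v].
    apply/subsetP => y; rewrite !inE => h; apply/andP.
    have [yu yv eu] : [/\ y != u, y != v & edge u y || edge v y].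
      case/or3P: h => [/eqP->|/eqP->|/and3P[yu yA vy]].
      - by rewrite ?uw ![w == _]eq_sym nvw nbr.
      - by rewrite ux nxv eq_sym nbr.
      - by rewrite yu vy orbT eq_sym nbr.
    rewrite negb_or yu yv; split=> //; apply/exists_inP.
    by case/orP: eu => e; [exists u | exists v]; rewrite ?inE ?eqxx ?orbT.
  (* By regularity N(v) - u has k - 1 elements; [w] and [x] are distinct and not adjacent to [v], so
     the total is k + 1. *)
  apply: leq_trans (subset_leq_card sub).
  have := deg v vA; rewrite (cardsD1 u) !inE uA edge_sym uv /= => <-.
  by rewrite !cardsU1 !inE (negPf evw) (negPf evx) !andbF orbF [w == x]eq_sym nxw.
have noP3 u v w : u \in A -> v \in A -> w \in A -> edge u v -> edge u w ->
    v != w -> edge v w.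
  move=> uA vA wA uv uw nvw; apply: contraT => evw.
  have wv : w != v by rewrite eq_sym.
  have ewv : ~~ edge w v by rewrite edge_sym.
  (* The contradiction sought is that every neighbour of [v] in [A] is one of [w]. *)
  case/negP: (critical_nbrs_sub crA wA vA wv ewv).
  (* Here k > 2 enters: [u] has a third neighbour [x], which [comm] makes adjacent to both [v] and
     [w]. *)
  have [x] : exists x, x \in nbrs_in A u :\ v :\ w.
    apply/set0Pn; rewrite -card_gt0.
    have := deg u uA; rewrite (cardsD1 v) (cardsD1 w) !inE wv vA wA uv uw /=.
    by lia.
  rewrite !inE => /and4P[xw xv xA ux].
  have vx := comm u v w x uA vA wA xA uv uw ux nvw evw xv xw.
  have wx := comm u w v x uA wA vA xA uw uv ux wv ewv xw xv.
  apply/subsetP => y; rewrite !inE => /andP[yA vy]; rewrite yA /=.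
  have yv : y != v by rewrite eq_sym nbr.
  have yw : y != w by apply: contraNneq evw => <-.
  have [->|yu] := eqVneq y u; first by rewrite edge_sym.
  have [uy|euy] := boolP (edge u y).
    exact: (comm u w v y).
  (* When [y] is not adjacent to [u], [comm] centred at [v] makes [y] adjacent to [x], and then
     [comm] centred at [x] makes it adjacent to [w]. *)
  have [->//|yx] := eqVneq y x.
  have yx' : edge y x.
    apply: (comm v y u x); rewrite // 1?edge_sym // 1?eq_sym //.
    exact: nbr.
  by apply: (comm x w v y); rewrite // edge_sym.
(* Without induced paths on three vertices, a closed neighbourhood in [A] is a clique; regularity
   gives it k + 1 vertices. *)
pose K := v0 |: nbrs_in A v0.
have cK : #|K| = k.+1 by rewrite cardsU1 deg // !inE edge_irrefl andbF.
have KK x y : x \in K -> y \in K -> x != y -> edge x y.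
  rewrite !inE => /orP[/eqP->|/andP[xA vx]] /orP[/eqP->|/andP[yA vy]] //.
  - by rewrite eqxx.
  - by rewrite edge_sym.
  - exact: (noP3 v0).
apply/complete_minorP; rewrite -cK; exists (fun i => [set enum_val i]).
split=> [i|i j ij]; first exact: connected_set1.
have nij : enum_val i != enum_val j by rewrite (inj_eq enum_val_inj).
rewrite /disjoint_adjacent disjoints1 !inE nij.
apply/adjacentP; exists (enum_val i), (enum_val j); rewrite !inE; split=> //.
by rewrite KK ?enum_valP.
Qed.

End Colourings.

(** * Chromatic and Hadwiger numbers of the product *)

Lemma chromatic_numberP (G : sgraph) : colorable G (chromatic_number G).
Proof. by rewrite /chromatic_number; case: ex_minnP. Qed.

Lemma chromatic_number_min (G : sgraph) k : colorable G k -> chromatic_number G <= k.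
Proof. by rewrite /chromatic_number; case: ex_minnP => m _; apply. Qed.

Lemma colorableW (G : sgraph) k l : k <= l -> colorable G k -> colorable G l.
Proof.
move=> kl /colorableP[c cc]; apply/colorableP.
by exists (fun x => widen_ord kl (c x)) => x y xT yT /(cc x y xT yT).
Qed.

Lemma ncolorable_lt (G : sgraph) k : k < chromatic_number G -> ~~ colorable G k.
Proof. by rewrite ltnNge; apply: contra; apply: chromatic_number_min. Qed.

(* Colour (x, y) by the sum of the two colours modulo k. *)
Lemma colorable_product (G H : sgraph) k :
  colorable G k -> colorable H k -> colorable (cartesian_product G H) k.
Proof.
(* Addition modulo k needs a nonempty ['I_k]; for k = 0 the product has no vertices. *)
move=> /colorableP[c cc] /colorableP[d dd]; apply/colorableP; case: k => [|k] in c cc d dd *.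
  have f (p : cartesian_product G H) : 'I_0 by case: (c p.1).
  by exists f => p; case: (f p).
exists (fun p => (c p.1 + d p.2)%R) => -[x y] [x' y'] _ _ /=.
rewrite /cart_rel /= => /orP[/andP[xx /eqP->]|/andP[/eqP-> yy]].
  by rewrite (inj_eq (GRing.addIr _)) cc ?inE.
by rewrite (inj_eq (GRing.addrI _)) dd ?inE.
Qed.

Lemma chromatic_number_product (G H : sgraph) :
  chromatic_number (cartesian_product G H)
    <= maxn (chromatic_number G) (chromatic_number H).
Proof.
apply/chromatic_number_min/colorable_product.
  exact: colorableW (leq_maxl _ _) (chromatic_numberP G).
exact: colorableW (leq_maxr _ _) (chromatic_numberP H).
Qed.

Lemma chromatic_number_gt1 (G : sgraph) :
  (exists x y : G, edge x y) -> 1 < chromatic_number G.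
Proof.
case=> x [y xy]; have /colorableP[c /(_ x y)] := chromatic_numberP G.
rewrite !inE xy => /(_ isT isT isT); case: chromatic_number c => [|[|n]] c //.
  by case: (c x).
by rewrite !ord1.
Qed.

(** The Boolean adds one when the chromatic numbers differ. Hence a gap of at most 1 puts the larger
    one strictly below the Hadwiger number, and a gap of 2 still leaves it at most equal. *)
Lemma hadwiger_product (G H : sgraph) :
    connected_graph H -> 1 < chromatic_number H <= chromatic_number G ->
  chromatic_number H + (chromatic_number H < chromatic_number G)
    < hadwiger_number (cartesian_product G H).
Proof.
(* With the chromatic number of [H] written d + 2, equality calls for two stars with d + 1
   neighbours; a strict gap calls for stars with d + 2 neighbours or the triangle construction. *)
move=> cH /andP[mH mG]; case E : (chromatic_number H) mH => [|[|d]] // _.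
have nH : ~~ colorable H d.+1 by rewrite ncolorable_lt ?E.
rewrite E in mG; apply: leq_hadwiger; case: ltnP => lt_mn.
  have nG : ~~ colorable G d.+2 by rewrite ncolorable_lt.
  have [[T [cT dT]]|mT] := star_or_complete_minor (ltn0Sn d) nH.
    have [S [cS dS]] := exists_star (ltn0Sn _) nG.
    by rewrite addn1; apply: minor_stars cH cS cT dS dT.
  by rewrite addn1; apply: minor_triangle_complete => //; apply: minor_triangle nG.
have nG : ~~ colorable G d.+1 by rewrite ncolorable_lt.
have [S [cS dS]] := exists_star (ltn0Sn _) nG.
have [T [cT dT]] := exists_star (ltn0Sn _) nH.
by rewrite addn0; apply: minor_stars cH cS cT dS dT.
Qed.

Lemma hadwiger_product_swap (G H : sgraph) :
  hadwiger_number (cartesian_product G H) <= hadwiger_number (cartesian_product H G).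
Proof.
rewrite {1}/hadwiger_number; case: ex_maxnP => k kGH _.
exact/leq_hadwiger/minor_product_swap.
Qed.

Import Order.TTheory GRing.Theory Num.Theory.
Local Open Scope ring_scope.

Theorem mainTheorem5 (G H : sgraph)
  (G_conn : connected_graph G) (H_conn : connected_graph H)
  (G_edge : exists x y : G, edge x y) (H_edge : exists x y : H, edge x y)
  (chi_dist :
    `|(chromatic_number G)%:Z - (chromatic_number H)%:Z| <= 2) :
  (chromatic_number (cartesian_product G H)
     <= hadwiger_number (cartesian_product G H))%N /\
  (`|(chromatic_number G)%:Z - (chromatic_number H)%:Z| <= 1 ->
   (chromatic_number (cartesian_product G H))%:Z
     <= (hadwiger_number (cartesian_product G H))%:Z - 1).
Proof.
have chi := chromatic_number_product G H.
have G1 := chromatic_number_gt1 G_edge; have H1 := chromatic_number_gt1 H_edge.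
(* This transfers the bound for the swapped product when [H] has the larger chromatic number. *)
have eta := hadwiger_product_swap H G.
have [le_HG|lt_GH] := leqP (chromatic_number H) (chromatic_number G).
  have := hadwiger_product H_conn (introT andP (conj H1 le_HG)).
  by lia.
have := hadwiger_product G_conn (introT andP (conj G1 (ltnW lt_GH))).
by lia.
Qed.
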